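(* Let $m\ge 2$ and $\tau=m-1$. For every instance with $m$ projects (and any number of agents), the solution $\mathbf{x}$ with $x_j=\frac12$ for all $j\in[m]$, whose total budget is $\frac m2$, satisfies all agents. In addition, for each such $m$ there exists an instance with $m$ projects such that the minimum budget necessary to satisfy all agents, i.e. the minimum of $\sum_{j=1}^m x_j$ over all solutions $\mathbf{x}$ satisfying all agents, is at least $\frac{m}{2}-\frac{1}{2m}$.
   Context: An instance with $n$ agents and $m$ projects consists of demands $d^i_j\in[0,1]$ for $i\in[n]=\{1,\dots,n\}$ and $j\in[m]$, here with $\sum_{j=1}^m d^i_j=1$ for every agent $i$. A solution is a vector $\mathbf{x}\in[0,1]^m$; its total budget is $\sum_{j=1}^m x_j$, which here may be smaller or larger than $1$. Given a threshold $\tau\in[1,m]$, agent $i$ is satisfied by $\mathbf{x}$ if the number of projects $j\in[m]$ with $x_j\ge d^i_j$ is at least $\tau$. *)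

(* Defs.v *)
(* The reals are an arbitrary [R : realType]. *)
From HB Require Import structures.
From mathcomp Require Import all_boot all_order all_algebra.
From mathcomp Require Import reals.
Set Implicit Arguments.
Unset Strict Implicit.
Unset Printing Implicit Defensive.
Import Order.TTheory GRing.Theory Num.Theory.
Local Open Scope ring_scope.

(* [d i j] is the demand of agent [i] for project [j]; agents and projects are
   numbered from 0. *)
Definition is_instance (R : realType) (n m : nat) (d : 'M[R]_(n, m)) : Prop :=
  (forall i j, 0 <= d i j <= 1) /\ (forall i, \sum_(j < m) d i j = 1).

Definition is_solution (R : realType) (m : nat) (x : 'rV[R]_m) : Prop :=
  forall j, 0 <= x ord0 j <= 1.

(* The total budget is not required to be at most 1. *)
Definition budget (R : realType) (m : nat) (x : 'rV[R]_m) : R :=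
  \sum_(j < m) x ord0 j.

Definition satisfied (R : realType) (n m : nat) (tau : nat)
    (d : 'M[R]_(n, m)) (x : 'rV[R]_m) (i : 'I_n) : bool :=
  (tau <= #|[set j : 'I_m | (d i j <= x ord0 j)%R]|)%N.

Definition satisfies_all (R : realType) (n m : nat) (tau : nat)
    (d : 'M[R]_(n, m)) (x : 'rV[R]_m) : Prop :=
  forall i, satisfied tau d x i.

(* [B] is a minimum, not merely an infimum: it is attained. *)
Definition is_min_budget (R : realType) (n m : nat) (tau : nat)
    (d : 'M[R]_(n, m)) (B : R) : Prop :=
  (exists x, [/\ is_solution x, satisfies_all tau d x & budget x = B]) /\
  (forall x, is_solution x -> satisfies_all tau d x -> B <= budget x).

Definition half_solution (R : realType) (m : nat) : 'rV[R]_m :=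
  \row_(j < m) (1 / 2).

(* Main.v *)
(** For the lower bound take the projects in cyclic order and an odd number
    [N = 2K + 1], and let the agents demand [t/N] of a project and [1 - t/N] of
    its successor, for [0 <= t <= N].  Rounding [x_j] up to the next point of
    the grid shows that satisfying these agents forces
    [x_j + x_(j+1) >= 1 - 1/N], and summing around the cycle gives the budget
    bound [(m/2) (1 - 1/N)].  As [N] is odd, [(1 - 1/N)/2 = K/N] is itself on the
    grid, so the constant solution [K/N] is feasible and the bound is attained.
    With [K = m^2] it is at least [m/2 - 1/(2m)]. *)
Require Import Defs.
From HB Require Import structures.
From mathcomp Require Import all_boot all_order all_algebra.
From mathcomp Require Import reals.
From mathcomp Require Import zify ring lra.
Set Implicit Arguments.
Unset Strict Implicit.
Unset Printing Implicit Defensive.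
Import Order.TTheory GRing.Theory Num.Theory.
Local Open Scope ring_scope.

(** At threshold [m - 1] the set of unmet projects has at most one element, so no two distinct
    projects are both unmet. *)
Lemma satisfied_all_but_oneP (R : realType) (n m : nat) (d : 'M[R]_(n, m))
    (x : 'rV[R]_m) (i : 'I_n) :
  reflect (forall j k, j != k -> d i j <= x ord0 j \/ d i k <= x ord0 k)
          (satisfied (m - 1)%N d x i).
Proof.
rewrite /satisfied; set A := [set j | _].
have -> : (m - 1 <= #|A|)%N = (#|~: A| <= 1)%N.
  by have := cardsC A; rewrite card_ord; lia.
apply: (iffP card_le1_eqP) => [H j k jk|H j k].
  have [Aj|Aj] := boolP (j \in A); first by left; rewrite inE in Aj.
  have [Ak|Ak] := boolP (k \in A); first by right; rewrite inE in Ak.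
  by case/eqP: jk; apply/esym; apply: H; rewrite inE.
rewrite !inE => /negP Aj /negP Ak; apply/eqP/negP => /negP jk.
by case: (H k j jk).
Qed.

Lemma instance_pair_le1 (R : realType) (n m : nat) (d : 'M[R]_(n, m))
    (i : 'I_n) (j k : 'I_m) :
  is_instance d -> j != k -> d i j + d i k <= 1.
Proof.
move=> [d01 d1] jk; rewrite -(d1 i) (bigD1 j) //= (bigD1 k) 1?eq_sym //=.
rewrite addrA lerDl; apply: sumr_ge0 => l _.
by case/andP: (d01 i l).
Qed.

(** Two demands above 1/2 would already exceed the agent's total demand 1. *)
Lemma half_satisfies_all (R : realType) (n m : nat) (d : 'M[R]_(n, m)) :
  is_instance d -> satisfies_all (m - 1)%N d (half_solution R m).
Proof.
move=> dI i; apply/satisfied_all_but_oneP => j k jk.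
have := instance_pair_le1 i dI jk; rewrite !mxE.
by case: (leP (d i j) (1 / 2)) => ?; [left | right; lra].
Qed.

Lemma budget_const (R : realType) (m : nat) (c : R) :
  budget (const_mx c : 'rV_m) = m%:R * c.
Proof.
rewrite /budget (eq_bigr (fun=> c)); last by move=> j _; rewrite mxE.
by rewrite sumr_const card_ord mulr_natl.
Qed.

Lemma ordS_neq (m : nat) (p : 'I_m) : (2 <= m)%N -> ordS p != p.
Proof.
move=> m2; apply/eqP => /(congr1 val) /=.
have [pm|pm] := ltnP p.+1 m; first by rewrite modn_small //; lia.
by have -> : p.+1 = m; [have := ltn_ord p; lia | rewrite modnn; lia].
Qed.

Section CyclicInstance.
Variables (R : realType) (m K : nat).
Hypothesis m_ge2 : (2 <= m)%N.
Let N := K.*2.+1.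

Definition cyclic_demand (a : 'I_m * 'I_N.+1) (j : 'I_m) : R :=
  if j == a.1 then a.2%:R / N%:R
  else if j == ordS a.1 then 1 - a.2%:R / N%:R else 0.

Definition cyclic_instance : 'M[R]_(#|{: 'I_m * 'I_N.+1}|, m) :=
  \matrix_(i, j) cyclic_demand (enum_val i) j.

Lemma grid_itv (t : 'I_N.+1) : 0 <= (t%:R / N%:R : R) <= 1.
Proof.
rewrite divr_ge0 //= ler_pdivrMr ?ltr0n // mul1r ler_nat -ltnS.
exact: ltn_ord.
Qed.

Lemma cyclic_instanceP : is_instance cyclic_instance.
Proof.
split=> [i j|i].
  rewrite mxE /cyclic_demand; have /andP[t0 t1] := grid_itv (enum_val i).2.
  by case: ifP => _; [|case: ifP => _]; rewrite ?lexx ?ler01 //; lra.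
under eq_bigr do rewrite mxE.
case: (enum_val i) => p t; rewrite (bigD1 p) //= (bigD1 (ordS p)) ?ordS_neq //=.
rewrite big1 => [|j /andP[/negPf jp /negPf jSp]].
  by rewrite /cyclic_demand /= !eqxx (negPf (ordS_neq _ _)) //; lra.
by rewrite /cyclic_demand /= jp jSp.
Qed.

Lemma cyclic_pair_ge (x : 'rV[R]_m) (p : 'I_m) :
  is_solution x -> satisfies_all (m - 1)%N cyclic_instance x ->
  1 - 1 / N%:R <= x ord0 p + x ord0 (ordS p).
Proof.
move=> xI xS; have /andP[x0 x1] := xI p; have /andP[y0 _] := xI (ordS p).
have N0 : 0 < N%:R :> R by rewrite ltr0n.
have N1 : 0 < 1 / N%:R :> R by rewrite divr_gt0.
(* Splitting off [x_p >= 1] ensures that a grid point strictly above [x_p] exists below. *)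
have [xge1|xlt1] := leP 1 (x ord0 p); first by lra.
have xN0 : 0 <= x ord0 p * N%:R by rewrite mulr_ge0 // ltW.
(* With [t] the floor of [x_p * N], agent [(p, t+1)] demands more than [x_p] of [p], so its demand
   [1 - (t+1)/N] at the successor must be met; add [t/N <= x_p]. *)
have /andP[] := truncn_itv xN0; set t := Num.truncn _ => tx xt.
have tN : (t.+1 < N.+1)%N.
  by rewrite ltnS -(ltr_nat R) (le_lt_trans tx) // gtr_pMl.
have /satisfied_all_but_oneP /(_ p (ordS p)) :=
  xS (enum_rank (p, Ordinal tN)).
rewrite eq_sym ordS_neq // => /(_ isT).
rewrite !mxE enum_rankK /cyclic_demand /= !eqxx (negPf (ordS_neq _ _)) //.
rewrite ler_pdivrMr // leNgt xt => -[//|].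
have : t%:R / N%:R <= x ord0 p by rewrite ler_pdivrMr.
by rewrite -natr1 mulrDl; lra.
Qed.

Lemma cyclic_budget_ge (x : 'rV[R]_m) :
  is_solution x -> satisfies_all (m - 1)%N cyclic_instance x ->
  m%:R * (K%:R / N%:R) <= budget x.
Proof.
move=> xI xS.
have : \sum_(p < m) (1 - 1 / N%:R) <=
       \sum_(p < m) (x ord0 p + x ord0 (ordS p)).
  by apply: ler_sum => p _; exact: cyclic_pair_ge.
(* The cyclic successor permutes the projects, so the sum over adjacent pairs is twice the
   budget. *)
have shift : budget x = \sum_(p < m) x ord0 (ordS p).
  exact: reindex_inj (@ordS_inj m).
rewrite sumr_const big_split /= -shift -/(budget x) -[_ *+ #|_|]mulr_natl card_ord.
have -> : 1 - 1 / N%:R = 2 * (K%:R / N%:R) :> R.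
  have : N%:R != 0 :> R by rewrite pnatr_eq0.
  by rewrite /N -natr1 -muln2 natrM => ?; field.
lra.
Qed.

Lemma cyclic_min_budget :
  is_min_budget (m - 1)%N cyclic_instance (m%:R * (K%:R / N%:R)).
Proof.
split; last exact: cyclic_budget_ge.
have N0 : 0 < N%:R :> R by rewrite ltr0n.
have KN : (K <= N)%N by rewrite /N; lia.
exists (const_mx (K%:R / N%:R)); split; last exact: budget_const.
  by move=> j; rewrite mxE divr_ge0 //= ler_pdivrMr // mul1r ler_nat.
move=> i; apply/satisfied_all_but_oneP => j k jk; rewrite !mxE.
case: (enum_val i) => p t; rewrite /cyclic_demand /=.
have c0 : 0 <= K%:R / N%:R :> R by rewrite divr_ge0.
(* Either [t <= K], or [t >= K + 1] and then [N - t <= K], because [N = 2K + 1]. *)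
have grid : t%:R / N%:R <= K%:R / N%:R :> R \/
            1 - t%:R / N%:R <= K%:R / N%:R :> R.
  have [tK|Kt] := leqP t K; [left|right].
    by rewrite ler_pM2r ?invr_gt0 // ler_nat.
  rewrite lerBlDl -mulrDl ler_pdivlMr // mul1r -natrD ler_nat.
  by move: (t : nat) Kt => s; rewrite /N; lia.
(* Unless [j] and [k] are [p] and its successor, one of them has demand 0. *)
case: (eqVneq j p) jk => [->|jp] jk.
  rewrite eq_sym (negPf jk).
  by case: ifP => _; [exact: grid | right].
case: (eqVneq j (ordS p)) jk => [->|jSp] jk; last by left.
case: (eqVneq k p) => [_|kp]; first by case: grid; [right|left].
by right; rewrite eq_sym (negPf jk).
Qed.

End CyclicInstance.

Theorem theorem10 (R : realType) (m : nat) (hm : (2 <= m)%N) :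
  [/\ is_solution (half_solution R m),
      budget (half_solution R m) = m%:R / 2,
      (forall (n : nat) (d : 'M[R]_(n, m)), is_instance d ->
         satisfies_all (m - 1)%N d (half_solution R m))
    & exists (n : nat) (d : 'M[R]_(n, m)),
        is_instance d /\
        exists B : R, is_min_budget (m - 1)%N d B /\
                      m%:R / 2 - 1 / (2 * m%:R) <= B].
Proof.
split.
- by move=> j; rewrite mxE; lra.
- have -> : half_solution R m = const_mx (1 / 2) by apply/rowP => j; rewrite !mxE.
  by rewrite budget_const mul1r.
- by move=> n d; exact: half_satisfies_all.
(* For [K = m^2] the loss [m / (2N)] against [m/2] is below [1 / (4m)], well within the allowed
   [1 / (2m)]. *)
exists _, (cyclic_instance R m (m ^ 2)); split; first exact: cyclic_instanceP.
exists (m%:R * ((m ^ 2)%:R / (m ^ 2).*2.+1%:R)); split.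
  exact: cyclic_min_budget.
have -> : (m ^ 2).*2.+1%:R = m%:R ^+ 2 * 2 + 1 :> R.
  by rewrite -natr1 -muln2 natrM natrX.
rewrite natrX.
have m0 : 0 < m%:R :> R by rewrite ltr0n; lia.
have N0 : 0 < m%:R ^+ 2 * 2 + 1 :> R by nra.
rewrite -subr_ge0.
have -> : m%:R * (m%:R ^+ 2 / (m%:R ^+ 2 * 2 + 1)) -
          (m%:R / 2 - 1 / (2 * m%:R)) =
          (m%:R ^+ 2 + 1) / (2 * m%:R * (m%:R ^+ 2 * 2 + 1)) :> R.
  by field; rewrite !gt_eqF.
by apply: divr_ge0; [nra | rewrite ltW // !mulr_gt0].
Qed.
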